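(* Let $R$ be an eDCTRS over a signature $\mathcal{F}$ which is $\mathbb{U}_{\mathrm{opt}}$-RL and $\mathbb{U}_{\mathrm{opt}}$-NE, and suppose that $R$ is non-LV or non-RV. Then $\mathbb{U}_{\mathrm{opt}}$ is sound for $R$, i.e., for all $s,t\in T(\mathcal{F},\mathcal{V})$, if $s\to^*_{\mathbb{U}_{\mathrm{opt}}(R)} t$ then $s\to^*_R t$.
   Context: Fix a countably infinite set $\mathcal{V}$ of variables; $T(\mathcal{F},\mathcal{V})$ is the set of terms over $\mathcal{F}$, $\mathrm{Var}(t_1,\dots,t_n)$ the set of variables occurring in the $t_i$. A term is linear if no variable occurs in it twice. An extended conditional rewrite rule over $\mathcal{F}$ is $\rho: l\to r\Leftarrow s_1\twoheadrightarrow t_1;\dots;s_k\twoheadrightarrow t_k$ ($k\ge0$), all terms in $T(\mathcal{F},\mathcal{V})$ ($l$ may be a variable); unconditional if $k=0$. An eCTRS is a set of such rules, an eTRS one with only unconditional rules (extra variables allowed). The rewrite relation of an eCTRS $R$ is $\to_R=\bigcup_n\to_{(n),R}$, $\to_{(0),R}=\emptyset$, $\to_{(i+1),R}=\{(C[l\sigma],C[r\sigma])\mid \text{rule in }R,\ s_j\sigma\to^*_{(i),R}t_j\sigma\text{ for all }j\}$. A rule is deterministic if $\mathrm{Var}(s_i)\subseteq\mathrm{Var}(l,t_1,\dots,t_{i-1})$ for all $i$; an eDCTRS is an eCTRS of deterministic rules. A rule is RL if $r$ is linear, NE if $\mathrm{Var}(l)\subseteq\mathrm{Var}(r)$, non-LV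 if $l\notin\mathcal{V}$, non-RV if $r\notin\mathcal{V}$; an eCTRS has such a property if all its rules do. Optimized unraveling: for a deterministic rule $\rho$ with $k\ge1$ let $X_i=\mathrm{Var}(l,t_1,\dots,t_{i-1})$, $Y_i=\mathrm{Var}(r,t_i,s_{i+1},t_{i+1},\dots,s_k,t_k)$, $Z_i=X_i\cap Y_i$, and $\overrightarrow{X}$ the list of elements of a finite set $X$ in a fixed order. With fresh symbols $U^\rho_1,\dots,U^\rho_k$ not in $\mathcal{F}$, $\mathbb{U}_{\mathrm{opt}}(\rho)=\{l\to U^\rho_1(s_1,\overrightarrow{Z_1})\}\cup\{U^\rho_i(t_i,\overrightarrow{Z_i})\to U^\rho_{i+1}(s_{i+1},\overrightarrow{Z_{i+1}})\mid1\le i<k\}\cup\{U^\rho_k(t_k,\overrightarrow{Z_k})\to r\}$, and $\mathbb{U}_{\mathrm{opt}}(\rho)=\{\rho\}$ if $\rho$ is unconditional; $\mathbb{U}_{\mathrm{opt}}(R)=\bigcup_{\rho\in R}\mathbb{U}_{\mathrm{opt}}(\rho)$. For a rule property P, $\rho$ is $\mathbb{U}_{\mathrm{opt}}$-P if all rules of $\mathbb{U}_{\mathrm{opt}}(\rho)$ have P; an eCTRS is $\mathbb{U}_{\mathrm{opt}}$-P if all its rules are. *)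

(* Defs.v *)
From Stdlib Require List.
From Stdlib Require Import Relation_Operators.
From mathcomp Require Import all_boot.

Set Implicit Arguments.
Unset Strict Implicit.
Unset Printing Implicit Defensive.

Record signature := Signature { sym :> Type; arity : sym -> nat }.

(* The countably infinite set of variables is [nat]. *)
Inductive term (F : signature) : Type :=
| Var (x : nat)
| App (f : F) (ts : {ffun 'I_(arity f) -> term F}).

Arguments Var {F} x.
Arguments App {F} f ts.

(* All variable occurrences, from left to right, with repetitions. *)
Fixpoint vars (F : signature) (t : term F) : seq nat :=
  match t with
  | Var x => [:: x]
  | App f ts => flatten [seq vars (ts i) | i <- enum 'I_(arity f)]
  end.

Definition linear (F : signature) (t : term F) : Prop := uniq (vars t).

Definition is_var (F : signature) (t : term F) : Prop := exists x, t = Var x.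

Fixpoint subst (F : signature) (sigma : nat -> term F) (t : term F) : term F :=
  match t with
  | Var x => sigma x
  | App f ts => App f [ffun i => subst sigma (ts i)]
  end.

(* In [CApp f i ts C] the [i]-th argument is [C]; the value [ts i] is unused. *)
Inductive ctx (F : signature) : Type :=
| Hole
| CApp (f : F) (i : 'I_(arity f)) (ts : {ffun 'I_(arity f) -> term F})
    (C : ctx F).

Arguments Hole {F}.
Arguments CApp {F} f i ts C.

Fixpoint fill (F : signature) (C : ctx F) (t : term F) : term F :=
  match C with
  | Hole => t
  | CApp f i ts C' => App f [ffun j => if j == i then fill C' t else ts j]
  end.

(* Extended conditional rewrite rules: [conds] lists the pairs [(s_j, t_j)]. *)
Record rule (F : signature) := Rule {
  lhs : term F;
  rhs : term F;
  conds : seq (term F * term F)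
}.

Definition eCTRS (F : signature) := rule F -> Prop.

Definition rules_have (P : forall G : signature, rule G -> Prop)
    (F : signature) (R : eCTRS F) : Prop :=
  forall rho, R rho -> P F rho.

Fixpoint rstep_lvl (F : signature) (R : eCTRS F) (n : nat)
    (s t : term F) : Prop :=
  match n with
  | 0 => False
  | n'.+1 =>
      exists (rho : rule F) (C : ctx F) (sigma : nat -> term F),
        [/\ R rho,
            s = fill C (subst sigma (lhs rho)),
            t = fill C (subst sigma (rhs rho))
          & forall c, List.In c (conds rho) ->
              clos_refl_trans _ (rstep_lvl R n')
                (subst sigma c.1) (subst sigma c.2)]
  end.

Definition rstep (F : signature) (R : eCTRS F) (s t : term F) : Prop :=
  exists n, rstep_lvl R n s t.

Definition rsteps (F : signature) (R : eCTRS F) : term F -> term F -> Prop :=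
  clos_refl_trans _ (rstep R).

Definition cond_idx (F : signature) (rho : rule F) := 'I_(size (conds rho)).

Definition cond_l (F : signature) (rho : rule F) (i : cond_idx rho) : term F :=
  (tnth (in_tuple (conds rho)) i).1.

Definition cond_r (F : signature) (rho : rule F) (i : cond_idx rho) : term F :=
  (tnth (in_tuple (conds rho)) i).2.

(* Conditions are numbered from 0, so [Xvars rho i] collects the variables of *)
(* the left-hand side and of the [t_j] with [j < i].                          *)
Definition Xvars (F : signature) (rho : rule F) (i : cond_idx rho) : seq nat :=
  vars (lhs rho) ++ flatten [seq vars c.2 | c <- take i (conds rho)].

Definition Yvars (F : signature) (rho : rule F) (i : cond_idx rho) : seq nat :=
  vars (rhs rho) ++ vars (cond_r i)
  ++ flatten [seq vars c.1 ++ vars c.2 | c <- drop i.+1 (conds rho)].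

(* The duplicate-free list of the elements of X_i \cap Y_i; the fixed order   *)
(* on variables is the usual one on [nat].                                    *)
Definition Zvars (F : signature) (rho : rule F) (i : cond_idx rho) : seq nat :=
  sort leq (undup [seq x <- Xvars i | x \in Yvars i]).

Definition deterministic (F : signature) (rho : rule F) : Prop :=
  forall i : cond_idx rho, {subset vars (cond_l i) <= Xvars i}.

Definition RL (F : signature) (rho : rule F) : Prop := linear (rhs rho).

Definition NE (F : signature) (rho : rule F) : Prop :=
  {subset vars (lhs rho) <= vars (rhs rho)}.

Definition nonLV (F : signature) (rho : rule F) : Prop := ~ is_var (lhs rho).

Definition nonRV (F : signature) (rho : rule F) : Prop := ~ is_var (rhs rho).

Definition eDCTRS (F : signature) (R : eCTRS F) : Prop :=
  rules_have (@deterministic) R.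

(* [USym rho i] is the fresh symbol U^rho_(i+1), one for each condition of    *)
(* each rule of [R].                                                          *)
Inductive usym (F : signature) (R : eCTRS F) : Type :=
| FSym (f : F)
| USym (rho : {rho | R rho}) (i : cond_idx (sval rho)).

Arguments FSym {F R} f.
Arguments USym {F R} rho i.

Definition uarity (F : signature) (R : eCTRS F) (g : usym R) : nat :=
  match g with
  | FSym f => arity f
  | USym rho i => (size (Zvars i)).+1
  end.

Definition usig (F : signature) (R : eCTRS F) : signature :=
  Signature (@uarity F R).

Fixpoint embed (F : signature) (R : eCTRS F) (t : term F) : term (usig R) :=
  match t with
  | Var x => Var x
  | App f ts => @App (usig R) (FSym f) [ffun i => embed R (ts i)]
  end.

(* U^rho_(i+1)(t, z_1, ..., z_m), where z_1, ..., z_m are the elements of     *)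
(* Z_(i+1).                                                                   *)
Definition uterm (F : signature) (R : eCTRS F) (rho : {rho | R rho})
    (i : cond_idx (sval rho)) (t : term F) : term (usig R) :=
  @App (usig R) (USym rho i)
    [ffun j : 'I_(size (Zvars i)).+1 =>
       nth (Var 0) (embed R t :: [seq Var x | x <- Zvars i]) j].

Inductive Uopt_rule (F : signature) (R : eCTRS F) (rho : {rho | R rho}) :
    rule (usig R) -> Prop :=
| Uopt_uncond :
    conds (sval rho) = [::] ->
    Uopt_rule rho
      (Rule (embed R (lhs (sval rho))) (embed R (rhs (sval rho))) [::])
| Uopt_first (i : cond_idx (sval rho)) :
    i = 0 :> nat ->
    Uopt_rule rho
      (Rule (embed R (lhs (sval rho))) (uterm i (cond_l i)) [::])
| Uopt_mid (i j : cond_idx (sval rho)) :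
    j = i.+1 :> nat ->
    Uopt_rule rho
      (Rule (uterm i (cond_r i)) (uterm j (cond_l j)) [::])
| Uopt_last (i : cond_idx (sval rho)) :
    i.+1 = size (conds (sval rho)) ->
    Uopt_rule rho
      (Rule (uterm i (cond_r i)) (embed R (rhs (sval rho))) [::]).

Definition Uopt (F : signature) (R : eCTRS F) : eCTRS (usig R) :=
  fun rho' => exists rho : {rho | R rho}, Uopt_rule rho rho'.

(* [R] is U_opt-P, for a property [P] of rules over any signature. *)
Definition Uopt_has (P : forall G : signature, rule G -> Prop)
    (F : signature) (R : eCTRS F) : Prop :=
  forall (rho : {rho | R rho}) (rho' : rule (usig R)),
    Uopt_rule rho rho' -> P (usig R) rho'.

Definition Uopt_sound (F : signature) (R : eCTRS F) : Prop :=
  forall s t : term F,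
    rsteps (Uopt (R := R)) (embed R s) (embed R t) -> rsteps R s t.

(* Main.v *)
(** The unraveled reduction is traversed backwards: by RL and NE the reversed
    rules are left-linear and have no extra variables, and a U-symbol records
    an application of its rule whose last conditions are already verified.
    [back t w] says that a term [t] with U-symbols can be completed to the
    U-free term [w]; it holds for the last term of the reduction, is inherited
    by predecessors, and for U-free [t] it entails that [t] reduces to [w]. *)
Require Import Defs.
From Stdlib Require Import Relation_Operators.
From mathcomp Require Import all_boot.

Set Implicit Arguments.
Unset Strict Implicit.
Unset Printing Implicit Defensive.

(** * Terms: induction, variables and linearity *)

Section Terms.
Variable F : signature.
Implicit Types (t : term F) (sigma : nat -> term F).

Lemma term_nested_ind (P : term F -> Prop) :
    (forall x, P (Var x)) ->
    (forall f (ts : {ffun 'I_(arity f) -> term F}),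
      (forall i, P (ts i)) -> P (App f ts)) ->
  forall t, P t.
Proof.
move=> PVar PApp; fix IH 1 => -[x|f ts]; first exact: PVar.
by apply: PApp => i; apply: IH.
Qed.

Lemma mem_vars_App x (f : F) (ts : {ffun 'I_(arity f) -> term F}) :
  reflect (exists i, x \in vars (ts i)) (x \in vars (App f ts)).
Proof.
apply: (iffP flatten_mapP) => [[i _ xi]|[i xi]]; exists i => //.
by rewrite mem_enum.
Qed.

Lemma subst_ext sigma sigma' t :
  {in vars t, sigma =1 sigma'} -> subst sigma t = subst sigma' t.
Proof.
elim/term_nested_ind: t => [x|f ts IH] eq_s /=.
  by apply: eq_s; rewrite mem_head.
congr App; apply/ffunP => i; rewrite !ffunE; apply: IH => x xi.
by apply: eq_s; apply/mem_vars_App; exists i.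
Qed.

Lemma linear_arg (f : F) (ts : {ffun 'I_(arity f) -> term F}) i :
  linear (App f ts) -> linear (ts i).
Proof.
rewrite /linear /=; have: i \in enum 'I_(arity f) by rewrite mem_enum.
elim: (enum _) => //= j s IH; rewrite inE cat_uniq.
by case/orP => [/eqP-> /and3P[]//|/IH{}IH /and3P[_ _ /IH]].
Qed.

(** Allows substitutions chosen separately for the arguments of a linear term to be glued: no
    variable receives two values. *)
Lemma linear_arg_inj (f : F) (ts : {ffun 'I_(arity f) -> term F}) i j x :
  linear (App f ts) -> x \in vars (ts i) -> x \in vars (ts j) -> i = j.
Proof.
rewrite /linear /= => + xi xj.
have: i \in enum 'I_(arity f) by rewrite mem_enum.
have: j \in enum 'I_(arity f) by rewrite mem_enum.
elim: (enum _) => //= k s IH; rewrite !inE cat_uniq.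
have notin l : l \in s -> x \in vars (ts l) -> x \in vars (ts k) ->
    ~~ has [in vars (ts k)] (flatten [seq vars (ts i) | i <- s]) -> False.
  by move=> ls xl xk /hasP[]; exists x => //; apply/flatten_mapP; exists l.
case/orP => [/eqP ejk|js]; case/orP => [/eqP eik|is_] /and3P[_ nh uq].
- by rewrite ejk.
- by subst j; case: (notin i).
- by subst i; case: (notin j).
- exact: IH.
Qed.

End Terms.

(** * Levels of conditional rewriting and closure under contexts *)

Section Rewriting.
Variables (F : signature) (R : eCTRS F).

Lemma rsteps_trans s t u : rsteps R s t -> rsteps R t u -> rsteps R s u.
Proof. exact: rt_trans. Qed.

Lemma rstep_lvlW n m s t : n <= m -> rstep_lvl R n s t -> rstep_lvl R m s t.
Proof.
elim: n m s t => [|n IH] [|m] s t //= le_nm [rho [C [sigma [Rrho -> -> Hc]]]].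
exists rho, C, sigma; split=> // c /Hc; elim=> [u v /(IH m _ _ le_nm)|u|u v w _ ? _ ?].
- exact: rt_step.
- exact: rt_refl.
- by apply: (@rt_trans _ _ _ v).
Qed.

Lemma rsteps_lvlW n m s t : n <= m ->
  clos_refl_trans _ (rstep_lvl R n) s t -> clos_refl_trans _ (rstep_lvl R m) s t.
Proof.
move=> le_nm; elim=> [u v /(rstep_lvlW le_nm)|u|u v w _ ? _ ?].
- exact: rt_step.
- exact: rt_refl.
- by apply: (@rt_trans _ _ _ v).
Qed.

Lemma rsteps_lvl s t :
  rsteps R s t -> exists n, clos_refl_trans _ (rstep_lvl R n) s t.
Proof.
elim=> [u v [n st]|u|u v w _ [n IHn] _ [m IHm]].
- by exists n; apply: rt_step.
- by exists 0; apply: rt_refl.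
- exists (maxn n m); apply: (@rt_trans _ _ _ v).
    by apply: rsteps_lvlW IHn; apply: leq_maxl.
  by apply: rsteps_lvlW IHm; apply: leq_maxr.
Qed.

(** There are finitely many conditions, so a maximum of their levels exists; the step lives one
    level above it. *)
Lemma rstep_root rho sigma : R rho ->
    (forall c, List.In c (conds rho) ->
      rsteps R (subst sigma c.1) (subst sigma c.2)) ->
  rstep R (subst sigma (lhs rho)) (subst sigma (rhs rho)).
Proof.
move=> Rrho Hc.
suff [n Hn] : exists n, forall c, List.In c (conds rho) ->
    clos_refl_trans _ (rstep_lvl R n) (subst sigma c.1) (subst sigma c.2).
  by exists n.+1, rho, Hole, sigma; split.
elim: (conds rho) Hc => [|c cs IH] Hc; first by exists 0.
have [n Hn] := rsteps_lvl (Hc c (or_introl erefl)).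
have [m Hm] := IH (fun d Hd => Hc d (or_intror Hd)).
exists (maxn n m) => d [<-|/Hm].
  by apply: rsteps_lvlW Hn; apply: leq_maxl.
by apply: rsteps_lvlW; apply: leq_maxr.
Qed.

Lemma rsteps_App_upd (f : F) i (ts : {ffun 'I_(arity f) -> term F}) s t :
  rsteps R s t ->
  rsteps R (App f [ffun j => if j == i then s else ts j])
           (App f [ffun j => if j == i then t else ts j]).
Proof.
elim=> [u v [[//|n] [rho [C [sigma [Rrho -> -> Hc]]]]]|u|u v w _ ? _ ?].
- by apply: rt_step; exists n.+1, rho, (CApp f i ts C), sigma; split.
- exact: rt_refl.
- by apply: (rsteps_trans (t := App f [ffun j => if j == i then v else ts j])).
Qed.

Lemma rsteps_App (f : F) (ss ts : {ffun 'I_(arity f) -> term F}) :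
  (forall i, rsteps R (ss i) (ts i)) -> rsteps R (App f ss) (App f ts).
Proof.
(* Invariant of the induction: arguments outside the list already agree; each round rewrites the one
   at the head index. *)
move=> st; have: forall i, i \notin enum 'I_(arity f) -> ss i = ts i.
  by move=> i; rewrite mem_enum.
elim: (enum _) ss st => [|i e IH] ss st eq_st.
  by have -> : ss = ts by [apply/ffunP => i; apply: eq_st]; apply: rt_refl.
apply: (@rt_trans _ _ _ (App f [ffun j => if j == i then ts i else ss j])).
  have {1}-> : ss = [ffun j => if j == i then ss i else ss j].
    by apply/ffunP => j; rewrite ffunE; case: eqP => [->|].
  exact: rsteps_App_upd.
apply: IH => j; rewrite ffunE; case: (eqVneq j i) => [->|nji] //.
  exact: rt_refl.
by move=> nje; apply: eq_st; rewrite inE negb_or nji.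
Qed.

End Rewriting.

(** * Unraveled terms and their completions *)

Section Unraveling.
Variables (F : signature) (R : eCTRS F).
Local Notation uterms := (term (usig R)).

Lemma vars_embed t : vars (embed R t) = vars t.
Proof.
elim/term_nested_ind: t => [x|f ts IH] //=.
by congr flatten; apply: eq_map => i; rewrite ffunE IH.
Qed.

(** Splits linearity of a U-term into linearity of [t], its disjointness from [Zvars i], and
    uniqueness in [Zvars i]. *)
Lemma vars_uterm (rho : {rho | R rho}) (i : cond_idx (sval rho)) t :
  vars (uterm i t) = vars t ++ Zvars i.
Proof.
rewrite /= enum_ordSl /= ffunE /= vars_embed; congr (_ ++ _).
set z := Zvars i.
rewrite -map_comp (eq_map (g := fun j : 'I_(size z) => [:: nth 0 z j])).
  rewrite -[RHS](mkseq_nth 0) /mkseq -val_enum_ord -map_comp.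
  by elim: (enum _) => //= j s ->.
by move=> j /=; rewrite ffunE /= (nth_map 0) /= add0n.
Qed.

Lemma nth_condE (rho : rule F) (c : term F * term F) :
  List.In c (conds rho) ->
  exists i : cond_idx rho, c.1 = cond_l i /\ c.2 = cond_r i.
Proof.
move=> Hc.
suff [i lt_i ->] : exists2 i, i < size (conds rho) & c = nth c (conds rho) i.
  by exists (Ordinal lt_i); rewrite /cond_l /cond_r !(tnth_nth c).
elim: (conds rho) Hc => //= d cs IH [->|/IH[i lt_i eq_c]]; first by exists 0.
by exists i.+1.
Qed.

Lemma rhs_Yvars (rho : rule F) (i : cond_idx rho) :
  {subset vars (rhs rho) <= Yvars i}.
Proof. by move=> x xr; rewrite mem_cat xr. Qed.

Lemma cond_r_Yvars (rho : rule F) (i : cond_idx rho) :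
  {subset vars (cond_r i) <= Yvars i}.
Proof. by move=> x xr; rewrite !mem_cat xr orbT. Qed.

Lemma cond_Yvars (rho : rule F) (i j : cond_idx rho) : i < j ->
  {subset vars (cond_l j) ++ vars (cond_r j) <= Yvars i}.
Proof.
move=> lt_ij x xj; rewrite !mem_cat; apply/orP; right; apply/orP; right.
apply/flattenP; exists (vars (cond_l j) ++ vars (cond_r j)) => //.
rewrite /cond_l /cond_r !(tnth_nth (Var 0, Var 0)) /= map_drop.
set f := fun c : term F * term F => _.
(* The pair of variable lists is entry [j - i.+1] of those after condition [i]. *)
rewrite -[_ ++ _]/(f _) -(nth_map _ [::]) // -(subnKC lt_ij) -nth_drop.
by apply: mem_nth; rewrite size_drop size_map ltn_sub2r // (leq_ltn_trans lt_ij).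
Qed.

(** The recursive calls are abstracted as [B] because the type of [ts] depends on [g]. Under [USym],
    the first argument may be at any stage of evaluating condition [i], so its target is an instance
    of [cond_r i]. *)
Fixpoint back (t : uterms) : term F -> Prop :=
  match t with
  | Var x => rsteps R (Var x)
  | App g ts =>
    match g return ('I_(uarity g) -> term F -> Prop) -> term F -> Prop with
    | FSym f => fun B w => exists ws : {ffun 'I_(arity f) -> term F},
        rsteps R (App f ws) w /\ forall i, B i (ws i)
    | USym rho i => fun B w => exists sigma,
        [/\ rsteps R (subst sigma (rhs (sval rho))) w,
            forall j : cond_idx (sval rho), i < j ->
              rsteps R (subst sigma (cond_l j)) (subst sigma (cond_r j))
          & forall k, B k (subst sigma
              (nth (Var 0) (cond_r i :: [seq Var x | x <- Zvars i]) k))]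
    end (fun i => back (ts i))
  end.

Lemma back_rsteps t w w' : back t w -> rsteps R w w' -> back t w'.
Proof.
case: t => [x|[f|rho i] ts] /=.
- by move=> xw ww'; apply: (rsteps_trans xw ww').
- by case=> ws [sw Hws] ww'; exists ws; split=> //; apply: (rsteps_trans sw ww').
- case=> sigma [sw Hj Hk] ww'; exists sigma; split=> //.
  exact: (rsteps_trans sw ww').
Qed.

Lemma back_embed s w : back (embed R s) w -> rsteps R s w.
Proof.
elim/term_nested_ind: s w => [x|f ts IH] w //= [ws [sw Hws]].
apply: (rsteps_trans _ sw); apply: rsteps_App => i.
by apply: IH; have := Hws i; rewrite ffunE.
Qed.

Lemma back_subst tau sigma t :
  (forall x, x \in vars t -> back (tau x) (sigma x)) ->
  back (subst tau (embed R t)) (subst sigma t).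
Proof.
elim/term_nested_ind: t => [x|f ts IH] ts_back /=.
  by apply: ts_back; rewrite mem_head.
exists [ffun i => subst sigma (ts i)]; split; first exact: rt_refl.
move=> i; rewrite !ffunE; apply: IH => x xi; apply: ts_back.
by apply/mem_vars_App; exists i.
Qed.

Lemma embed_back t : back (embed R t) t.
Proof.
elim/term_nested_ind: t => [x|f ts IH] /=; first exact: rt_refl.
by exists ts; split=> [|i]; [exact: rt_refl|rewrite ffunE].
Qed.

(** Right-linearity enters here: two occurrences of a variable could be completed differently,
    whereas a linear term lets the matchers of its arguments be combined. *)
Lemma back_match tau t w : linear t -> back (subst tau (embed R t)) w ->
  exists2 sigma, rsteps R (subst sigma t) w
    & forall x, x \in vars t -> back (tau x) (sigma x).
Proof.
elim/term_nested_ind: t w => [x|f ts IH] w lin_t /=.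
  move=> bw; exists (fun=> w) => [|y]; first exact: rt_refl.
  by rewrite inE => /eqP->.
case=> ws [sw Hws].
have /fin_all_exists2[sg sg_ws sg_back] : forall i, exists2 sigma,
    rsteps R (subst sigma (ts i)) (ws i)
    & forall x, x \in vars (ts i) -> back (tau x) (sigma x).
  move=> i; apply: IH; first exact: linear_arg lin_t.
  by have := Hws i; rewrite !ffunE.
(* Each variable takes its value from the argument containing it; the default [Var x] only concerns
   variables outside the term. *)
pose sigma x := if [pick i | x \in vars (ts i)] is Some i then sg i x else Var x.
have sigmaE i x : x \in vars (ts i) -> sigma x = sg i x.
  rewrite /sigma => xi; case: pickP => [j xj|/(_ i)]; last by rewrite xi.
  by rewrite (linear_arg_inj lin_t xj xi).
exists sigma => [|x /mem_vars_App[i xi]]; last by rewrite (sigmaE i) //; apply: sg_back.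
apply: (rsteps_trans _ sw); apply: rsteps_App => i; rewrite ffunE.
by rewrite (subst_ext (sigma' := sg i)) // => x; apply: sigmaE.
Qed.

(** In both clauses for applications, [back] is monotone in the completions of the arguments. *)
Lemma back_fill (C : ctx (usig R)) p q w :
    (forall v, back q v -> back p v) ->
  back (fill C q) w -> back (fill C p) w.
Proof.
move=> qp; elim: C w => [|g i ts C IH] w; first exact: qp.
have mono k v : back ([ffun j => if j == i then fill C q else ts j] k) v ->
    back ([ffun j => if j == i then fill C p else ts j] k) v.
  by rewrite !ffunE; case: eqP => // _; apply: IH.
case: g i ts mono => [f|rho k] i ts mono /=.
  by case=> ws [sw Hws]; exists ws; split=> // j; apply: mono.
by case=> sigma [sw Hj Hk]; exists sigma; split=> // j; apply: mono.
Qed.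

(** * Reversing the rules of the unraveling *)

Section Rule.
Variable rho : {rho | R rho}.
Local Notation rl := (sval rho).
Implicit Types i j : cond_idx rl.

Lemma back_uterm_intro i tau sigma w :
    rsteps R (subst sigma (rhs rl)) w ->
    (forall j, i < j ->
      rsteps R (subst sigma (cond_l j)) (subst sigma (cond_r j))) ->
    (forall x, x \in vars (uterm i (cond_r i)) -> back (tau x) (sigma x)) ->
  back (subst tau (uterm i (cond_r i))) w.
Proof.
move=> sw Hj tau_sigma; exists sigma; split=> // k; rewrite !ffunE.
move: tau_sigma; rewrite vars_uterm => tau_sigma.
case: k => -[|k] lt_k /=.
  by apply: back_subst => x xr; apply: tau_sigma; rewrite mem_cat xr.
rewrite !(nth_map 0) //=; apply: tau_sigma.
by rewrite mem_cat mem_nth ?orbT.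
Qed.

(* Determinism puts every variable of [cond_l i] in X_i; as [cond_l i] shares *)
(* no variable with Z_i, it shares none with Y_i, so that a matcher of        *)
(* [cond_l i] can be merged with the substitution recorded by [back].         *)
Lemma back_uterm_elim i tau w : deterministic rl ->
    linear (uterm i (cond_l i)) -> back (subst tau (uterm i (cond_l i))) w ->
  exists sigma, [/\ rsteps R (subst sigma (rhs rl)) w,
    forall j, i <= j ->
      rsteps R (subst sigma (cond_l j)) (subst sigma (cond_r j))
    & forall x, x \in vars (uterm i (cond_l i)) -> back (tau x) (sigma x)].
Proof.
move=> det; rewrite /linear vars_uterm cat_uniq => /and3P[lin_l /hasPn disj _].
case=> sigma [sw Hj Hk].
(* The first argument, an instance of [cond_l i], completes to an instance of [cond_r i]; matching
   it verifies condition [i] itself, hence [i <= j] in the conclusion. *)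
have := Hk ord0; rewrite !ffunE /= => /(back_match lin_l)[sg sg_r sg_back].
have freshY x : x \in Yvars i -> x \notin vars (cond_l i).
  move=> xY; apply/negP => xl; suff /disj/negP : x \in Zvars i by [].
  by rewrite mem_sort mem_undup mem_filter xY det.
pose th x := if x \in vars (cond_l i) then sg x else sigma x.
have thY t : {subset vars t <= Yvars i} -> subst th t = subst sigma t.
  by move=> tY; apply: subst_ext => x /tY/freshY; rewrite /th => /negbTE->.
exists th; split=> [|j|x]; first by rewrite thY //; apply: rhs_Yvars.
  rewrite leq_eqVlt => /orP[/eqP/val_inj<-|lt_ij].
    rewrite [in subst _ (cond_r i)]thY; last exact: cond_r_Yvars.
    by rewrite (subst_ext (sigma' := sg)) // => x; rewrite /th => ->.
  by rewrite !thY; [exact: Hj | |] => x xj;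
    apply: (cond_Yvars lt_ij); rewrite mem_cat xj ?orbT.
rewrite mem_cat => /orP[xl|xz]; first by rewrite /th xl; apply: sg_back.
rewrite /th (negbTE (disj _ xz)).
(* Slot 0 holds the condition term, which shifts the elements of [Zvars i] by one. *)
have lt_k : (index x (Zvars i)).+1 < (size (Zvars i)).+1 by rewrite ltnS index_mem.
by have := Hk (Ordinal lt_k); rewrite !ffunE /= !(nth_map 0) ?index_mem //= nth_index.
Qed.

(** Read from right to left, the last rule opens a record with no later condition to check, a middle
    rule adds condition [j], and the first rule has all conditions verified. NE carries the
    completions of variables over to the left-hand side. *)
Lemma back_Uopt_rule rho' tau w : deterministic rl ->
    (forall rho'', Uopt_rule rho rho'' -> RL rho'' /\ NE rho'') ->
    Uopt_rule rho rho' ->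
  back (subst tau (rhs rho')) w -> back (subst tau (lhs rho')) w.
Proof.
move=> det RLNE Hrho'; have [lin ne] := RLNE _ Hrho'.
(* Once all conditions hold, [rho] applies at the root of the completed left-hand side. *)
have root sigma : rsteps R (subst sigma (rhs rl)) w ->
    (forall j, rsteps R (subst sigma (cond_l j)) (subst sigma (cond_r j))) ->
    (forall x, x \in vars (lhs rl) -> back (tau x) (sigma x)) ->
    back (subst tau (embed R (lhs rl))) w.
  move=> sw Hj tau_sigma; apply: (back_rsteps (back_subst tau_sigma)).
  apply: (rsteps_trans _ sw); apply: rt_step; apply: rstep_root; first exact: (svalP rho).
  by move=> c /nth_condE[j [-> ->]].
case: Hrho' lin ne => /= [c0|i i0|i j ij|i il]; rewrite /RL /NE /= => lin ne.
- move: lin ne; rewrite /linear !vars_embed => lin ne.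
  case/(back_match lin) => sigma sw tau_sigma.
  apply: (root _ sw) => [[j lt_j]|x /ne]; last exact: tau_sigma.
  by exfalso; move: lt_j; rewrite c0.
- case/(back_uterm_elim det lin) => sigma [sw Hj tau_sigma].
  apply: (root _ sw) => [j|x xl]; first by apply: Hj; rewrite i0.
  by apply: tau_sigma; apply: ne; rewrite vars_embed.
- case/(back_uterm_elim det lin) => sigma [sw Hj tau_sigma].
  apply: (back_uterm_intro sw) => [k lt_ik|x /ne]; last exact: tau_sigma.
  by apply: Hj; rewrite ij.
- move: lin ne; rewrite /linear vars_embed => lin ne.
  case/(back_match lin) => sigma sw tau_sigma.
  apply: (back_uterm_intro sw) => [k lt_ik|x /ne]; last exact: tau_sigma.
  by exfalso; have := ltn_ord k; rewrite -[X in _ < X]il ltnS leqNgt lt_ik.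
Qed.

End Rule.

End Unraveling.

Theorem theorem4p9 (F : signature) (R : eCTRS F)
    (hdet : eDCTRS R)
    (hRL : Uopt_has (@RL) R)
    (hNE : Uopt_has (@NE) R)
    (hnv : rules_have (@nonLV) R \/ rules_have (@nonRV) R) :
  Uopt_sound R.
Proof.
move=> s t st; apply: back_embed.
(* Steps are undone from the last one to the first, starting from the completion of [embed R t] to
   [t]. *)
have back_steps u v w : rsteps (Uopt (R := R)) u v -> back v w -> back u w.
  move=> uv; elim: uv w => [{}u {}v Huv|{}u|{}u v1 {}v _ IH1 _ IH2] w //; last first.
    by move/IH2/IH1.
  case: Huv => -[//|n] [rho' [C [tau [[rho Hrho'] -> -> _]]]].
  apply: back_fill => v'; apply: back_Uopt_rule Hrho'.
    exact: hdet (svalP rho).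
  by move=> rho'' Hr; split; [apply: hRL Hr|apply: hNE Hr].
exact: back_steps st (embed_back R t).
Qed.
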